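(* If $f\in\mathcal{C}_n$ and $r\in[-1,1]\setminus\{0\}$, then the function $f_r:\Gamma_+\to\mathbb{R}$ given by $f_r(x_1,\dots,x_n)=\big(f(x_1^r,\dots,x_n^r)\big)^{1/r}$ belongs to $\mathcal{C}_n$.
   Context: $\Gamma_+=\{x\in\mathbb{R}^n: x_i>0\ \forall i\}$. $\mathcal{C}_n$ is the class of functions $f:\Gamma_+\to\mathbb{R}$ which are $C^\infty$, homogeneous of degree one ($f(cx)=cf(x)$ for $c>0$), strictly monotone increasing ($\partial f/\partial x_i>0$ for each $i$), concave, and inverse-concave, meaning $f^*(x_1,\dots,x_n)=-f(x_1^{-1},\dots,x_n^{-1})$ is concave on $\Gamma_+$. *)

(* Defs.v *)
From HB Require Import structures.
From mathcomp Require Import all_boot all_order all_algebra.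
From mathcomp Require Import all_classical all_reals all_analysis.
Set Implicit Arguments. Unset Strict Implicit. Unset Printing Implicit Defensive.
Import Order.TTheory GRing.Theory Num.Theory.
Import numFieldNormedType.Exports.
Local Open Scope classical_set_scope.
Local Open Scope ring_scope.

Section Cn.
Variables (R : realType) (n : nat).

Definition Gamma_plus : set 'rV[R]_n := [set x | forall i : 'I_n, 0 < x ord0 i].

Definition ebasis (i : 'I_n) : 'rV[R]_n := delta_mx ord0 i.

Definition pderiv (i : 'I_n) (g : 'rV[R]_n -> R) : 'rV[R]_n -> R :=
  fun x => derive g x (ebasis i).

Definition iter_pderiv (s : seq 'I_n) (g : 'rV[R]_n -> R) : 'rV[R]_n -> R :=
  foldr pderiv g s.

Definition smooth_on_Gamma (f : 'rV[R]_n -> R) : Prop :=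
  forall (s : seq 'I_n) (x : 'rV[R]_n), Gamma_plus x ->
    {for x, continuous (iter_pderiv s f)} /\
    forall i : 'I_n, derivable (iter_pderiv s f) x (ebasis i).

Definition homogeneous1 (f : 'rV[R]_n -> R) : Prop :=
  forall (c : R) (x : 'rV[R]_n), 0 < c -> Gamma_plus x -> f (c *: x) = c * f x.

Definition strictly_monotone (f : 'rV[R]_n -> R) : Prop :=
  forall (x : 'rV[R]_n), Gamma_plus x -> forall i : 'I_n, 0 < pderiv i f x.

Definition concave_on_Gamma (f : 'rV[R]_n -> R) : Prop :=
  forall (x y : 'rV[R]_n) (t : R), Gamma_plus x -> Gamma_plus y ->
    0 <= t <= 1 ->
    (1 - t) * f x + t * f y <= f ((1 - t) *: x + t *: y).

Definition inv_vec (x : 'rV[R]_n) : 'rV[R]_n := map_mx (fun t => t^-1) x.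

Definition fstar (f : 'rV[R]_n -> R) : 'rV[R]_n -> R := fun x => - f (inv_vec x).

Definition inverse_concave (f : 'rV[R]_n -> R) : Prop :=
  concave_on_Gamma (fstar f).

(* the class C_n (f is only relevant on Gamma_+) *)
Definition class_C (f : 'rV[R]_n -> R) : Prop :=
  [/\ smooth_on_Gamma f, homogeneous1 f, strictly_monotone f,
      concave_on_Gamma f & inverse_concave f].

Definition f_pow (f : 'rV[R]_n -> R) (r : R) : 'rV[R]_n -> R :=
  fun x => powR (f (map_mx (fun t => powR t r) x)) r^-1.

End Cn.

(* Main.v *)
(* For a positive function that is homogeneous of degree one, concavity follows
   from convexity of the superlevel set [{g >= 1}].  For [0 < r <= 1] we have
   [f_r x >= 1] iff [f (x^r) >= 1], and [x |-> f (x^r)] is concave because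
   [t |-> t^r] is concave and [f] is increasing and concave.  For [-1 <= r < 0]
   we have [f_r x >= 1] iff [f (x^r) <= 1], and [x |-> f (1 / x^(-r))] is convex
   because [t |-> t^(-r)] is concave and [u |-> f (1 / u)] is decreasing and, by
   inverse-concavity, convex.  Finally [f_r (1 / x) = 1 / f_(-r) x], so
   inverse-concavity of [f_r] follows from concavity of [f_(-r)].
   Smoothness is the chain rule, iterated through the classes [C_k]. *)

Require Import Defs.
From mathcomp Require Import all_boot all_order all_algebra.
From mathcomp Require Import all_classical all_reals all_analysis.
From mathcomp Require Import ring.
Import Order.TTheory GRing.Theory Num.Theory.
Import numFieldNormedType.Exports.
Set Implicit Arguments.
Unset Strict Implicit.
Unset Printing Implicit Defensive.
Local Open Scope classical_set_scope.
Local Open Scope ring_scope.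

(** * Chain rules along coordinate lines and stability of smoothness under powers *)

Section Smoothness.
Variables (R : realType) (n : nat).
Implicit Types (f g : 'rV[R]_n -> R) (x : 'rV[R]_n) (i : 'I_n) (a : R).

Local Notation Gamma := (@Gamma_plus R n).

Definition map_powR a x : 'rV[R]_n := map_mx (fun t => t `^ a) x.

Lemma Gamma_map_powR a x : Gamma x -> Gamma (map_powR a x).
Proof. by move=> x0 i; rewrite mxE powR_gt0. Qed.

Lemma nbhs_Gamma x : Gamma x -> nbhs x Gamma.
Proof.
move=> x0; exists (fun _ _ => [set t : R | 0 < t]) => [i j|y xy i]; last exact: xy.
by rewrite (ord1 i); apply: lt_nbhsr; exact: x0.
Qed.

Lemma continuous_powR a (t : R) : 0 < t -> {for t, continuous (@powR R ^~ a)}.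
Proof.
move=> t0; apply/differentiable_continuous/derivable1_diffP.
by apply: ex_derive; exact: is_derive1_powR.
Qed.

Lemma continuous_map_powR a x : Gamma x -> {for x, continuous (map_powR a)}.
Proof.
move=> x0 A [P xP PA].
exists (fun k j => (@powR R ^~ a) @^-1` P k j) => [i j|y yP].
  have xij : 0 < x i j by rewrite (ord1 i).
  by apply: (continuous_powR xij); have := xP i j; rewrite mxE.
by apply: PA => i j; rewrite mxE; exact: yP.
Qed.

(* Since [map_powR] acts coordinatewise, it maps coordinate lines to coordinate
   lines: partial derivatives only need the one-variable chain rule. *)
Lemma map_powR_line a x i (h : R) :
  map_powR a (h *: ebasis R i + x) =
  ((h + x ord0 i) `^ a - x ord0 i `^ a) *: ebasis R i + map_powR a x.
Proof.
apply/rowP => j; rewrite !mxE eqxx /=; case: eqVneq => [->|_] /=.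
  by rewrite !mulr1 subrK.
by rewrite !mulr0 !add0r.
Qed.

(** The two difference quotients are the same function of [h]; this reduces partial derivatives to
    one-variable calculus. *)
Lemma is_derive_line f x i (d : R) :
  is_derive x (ebasis R i) f d <->
  is_derive (0 : R) 1 (fun h : R => f (h *: ebasis R i + x)) d.
Proof.
have E : 'D_(ebasis R i) f x = 'D_1 (fun h : R => f (h *: ebasis R i + x)) 0.
  rewrite /derive; set g1 := fun h => h^-1 *: _; set g2 := fun h => h^-1 *: _.
  suff -> : g1 = g2 by [].
  by apply/funext => h; rewrite /g1 /g2 /= addr0 scale0r add0r [_%:A]mulr1.
split=> -[df <-]; split; rewrite -?E //; first exact: (derivable1P f x _).1.
exact: (derivable1P f x _).2.
Qed.

Lemma is_derive_comp1 (g k : R -> R) (t dk dg : R) :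
  is_derive t 1 k dk -> is_derive (k t) 1 g dg ->
  is_derive t 1 (g \o k) (dg * dk).
Proof.
move=> [kt <-] [gt <-]; split; last by rewrite -!derive1E derive1_comp.
by apply/derivable1_diffP/differentiable_comp; exact/derivable1_diffP.
Qed.

Lemma is_derive_comp_map_powR f x i a (d : R) : Gamma x ->
  is_derive (map_powR a x) (ebasis R i) f d ->
  is_derive x (ebasis R i) (f \o map_powR a) (d * (a * x ord0 i `^ (a - 1))).
Proof.
move=> x0 /is_derive_line df; apply/is_derive_line.
pose k (h : R) := (h + x ord0 i) `^ a - x ord0 i `^ a.
have -> : (fun h => (f \o map_powR a) (h *: ebasis R i + x)) =
   (fun s => f (s *: ebasis R i + map_powR a x)) \o k.
  by apply/funext => h /=; rewrite map_powR_line.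
apply: is_derive_comp1; last by rewrite /k add0r subrr.
have xi : 0 < 0 + x ord0 i by rewrite add0r.
have dk := is_derive_comp1 (is_derive_shift 0 1 (x ord0 i)) (is_derive1_powR a xi).
have := is_deriveB dk (is_derive_cst (x ord0 i `^ a) (0 : R) (1 : R)).
by rewrite subr0 mulr1 add0r.
Qed.

Lemma is_derive_powR_comp f x i a (d : R) : 0 < f x ->
  is_derive x (ebasis R i) f d ->
  is_derive x (ebasis R i) (fun y => f y `^ a) (a * f x `^ (a - 1) * d).
Proof.
move=> fx /is_derive_line df; apply/is_derive_line.
apply: (is_derive_comp1 df (g := @powR R ^~ a)).
by rewrite scale0r add0r; exact: is_derive1_powR.
Qed.

(** Recursion on the order peels off the derivative taken first, so closure properties can be proved
    by induction on [k]. *)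
Fixpoint C_k (k : nat) f : Prop :=
  (forall x, Gamma x -> {for x, continuous f}) /\
  (if k is k'.+1 then forall i,
     (forall x, Gamma x -> derivable f x (ebasis R i)) /\ C_k k' (pderiv i f)
   else True).

Lemma C_kW k f : C_k k.+1 f -> C_k k f.
Proof.
elim: k f => [|k IH] f [fc df]; split=> // i.
by have [? /IH] := df i; split.
Qed.

(** In [iter_pderiv] the last index of the list is differentiated first, hence the induction on
    lists from the right. *)
Lemma smooth_C_k f : smooth_on_Gamma f <-> forall k, C_k k f.
Proof.
have iterS s i g : iter_pderiv (rcons s i) g = iter_pderiv s (pderiv i g).
  by rewrite /iter_pderiv foldr_rcons.
split=> [sf k|].
  elim: k f sf => [|k IH] f sf.
    by split=> // x x0; exact: (sf [::] x x0).1.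
  split=> [x x0|i]; first exact: (sf [::] x x0).1.
  split=> [x x0|]; first exact: (sf [::] x x0).2.
  by apply: IH => s x x0; rewrite -iterS; exact: sf.
move=> cf s; elim/last_ind: s f cf => [|s i IH] f cf x x0.
  by split=> [|i]; [exact: (cf 0%N).1 | exact: ((cf 1%N).2 i).1].
by rewrite iterS; apply: IH => // k; exact: ((cf k.+1).2 i).2.
Qed.

Lemma near_eq_continuous f g x : (\near x, f x = g x) ->
  {for x, continuous f} -> {for x, continuous g}.
Proof.
move=> fg cf; change (g @ x --> g x); rewrite -(nbhs_singleton fg).
by apply: (cvg_trans _ cf); exact: (@near_eq_cvg _ _ (nbhs x) _ f g fg).
Qed.

(** [Gamma] is open, so functions equal on it agree near each of its points and have the same
    partial derivatives there. *)
Lemma eq_C_k k f g : {in Gamma, f =1 g} -> C_k k f -> C_k k g.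
Proof.
have fgx f1 g1 x : {in Gamma, f1 =1 g1} -> Gamma x -> \near x, f1 x = g1 x.
  by move=> fg /nbhs_Gamma; apply: filterS => y y0; apply: fg; rewrite inE.
elim: k f g => [|k IH] f g fg [cf df].
  by split=> // x x0; exact: near_eq_continuous (fgx _ _ _ fg x0) (cf x x0).
split=> [x x0|i]; first exact: near_eq_continuous (fgx _ _ _ fg x0) (cf x x0).
have [dfi cfi] := df i; split=> [x x0|].
  exact: near_eq_derivable (fgx _ _ _ fg x0) (dfi x x0).
apply: IH cfi => x; rewrite inE => x0.
exact: near_eq_derive (fgx _ _ _ fg x0).
Qed.

(** Lets an explicit formula, valid only on [Gamma], stand in for [pderiv i f]. *)
Lemma C_kS k f : (forall x, Gamma x -> {for x, continuous f}) ->
  (forall i, exists2 d, C_k k d &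
     forall x, Gamma x -> is_derive x (ebasis R i) f (d x)) -> C_k k.+1 f.
Proof.
move=> cf df; split=> // i; have [d cd fd] := df i.
split=> [x x0|]; first by have fx := fd x x0; exact: ex_derive.
apply: eq_C_k cd => x; rewrite inE => /fd x0.
by rewrite /pderiv derive_val.
Qed.

Lemma C_k_is_derive k f i x : C_k k.+1 f -> Gamma x ->
  is_derive x (ebasis R i) f (pderiv i f x).
Proof. by move=> [_ /(_ i)[df _]] /df/derivableP. Qed.

Lemma C_k_cst k a : C_k k (cst a).
Proof.
elim: k a => [|k IH] a; first by split=> // x _; exact: cst_continuous.
apply: C_kS => [x _|i]; first exact: cst_continuous.
by exists (cst 0) => [|x _]; [exact: IH | exact: is_derive_cst].
Qed.

Lemma C_kD k f g : C_k k f -> C_k k g -> C_k k (f + g).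
Proof.
have contD f1 g1 x : {for x, continuous f1} -> {for x, continuous g1} ->
  {for x, continuous (f1 + g1)} by exact: continuousD.
elim: k f g => [|k IH] f g fk gk.
  by split=> // x x0; apply: contD; [exact: fk.1 | exact: gk.1].
apply: C_kS => [x x0|i]; first by apply: contD; [exact: fk.1 | exact: gk.1].
exists (pderiv i f + pderiv i g).
  by apply: IH; [exact: (fk.2 i).2 | exact: (gk.2 i).2].
by move=> x x0; apply: is_deriveD; apply: C_k_is_derive x0; [exact: fk|exact: gk].
Qed.

Lemma C_kM k f g : C_k k f -> C_k k g -> C_k k (f * g).
Proof.
have contM f1 g1 x : {for x, continuous f1} -> {for x, continuous g1} ->
  {for x, continuous (f1 * g1)} by exact: continuousM.
elim: k f g => [|k IH] f g fk gk.
  by split=> // x x0; apply: contM; [exact: fk.1 | exact: gk.1].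
apply: C_kS => [x x0|i]; first by apply: contM; [exact: fk.1 | exact: gk.1].
exists (f * pderiv i g + g * pderiv i f).
  by apply: C_kD; apply: IH;
    [exact: C_kW|exact: (gk.2 i).2|exact: C_kW|exact: (fk.2 i).2].
by move=> x x0; apply: is_deriveM; apply: C_k_is_derive x0; [exact: fk|exact: gk].
Qed.

Lemma C_k_coord k i : C_k k (fun x => x ord0 i).
Proof.
case: k => [|k]; first by split=> // x _; exact: coord_continuous.
apply: C_kS => [x _|j]; first exact: coord_continuous.
exists (cst (i == j)%:R); first exact: C_k_cst.
move=> x _; apply/is_derive_line.
have -> : (fun h : R => (h *: ebasis R j + x) ord0 i) =
  (fun h => h * (i == j)%:R + x ord0 i).
  by apply/funext => h; rewrite !mxE eqxx.
apply: is_derive_eq.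
by rewrite /= addr0 scaler0 add0r [_ *: 1]mulr1.
Qed.

Lemma C_k_powR k f a : (forall x, Gamma x -> 0 < f x) ->
  C_k k f -> C_k k (fun x => f x `^ a).
Proof.
move=> f0; have contP (b : R) x : Gamma x -> {for x, continuous f} ->
    {for x, continuous (fun y => f y `^ b)}.
  move=> x0 cf; apply: (@continuous_comp _ _ _ f (@powR R ^~ b)) => //.
  exact/continuous_powR/f0.
(* The exponent must vary in the induction: the derivative contains the power [a - 1] of [f]. *)
elim: k a => [|k IH] a fk; first by split=> // x x0; apply: contP => //; exact: fk.1.
apply: C_kS => [x x0|i]; first by apply: contP => //; exact: fk.1.
exists (cst a * (fun x => f x `^ (a - 1)) * pderiv i f).
  apply: C_kM; last exact: (fk.2 i).2.
  by apply: C_kM; [exact: C_k_cst|apply: IH; exact: C_kW].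
move=> x x0; apply: is_derive_powR_comp; first exact: f0.
exact: C_k_is_derive fk x0.
Qed.

Lemma C_k_comp_map_powR k f a : C_k k f -> C_k k (f \o map_powR a).
Proof.
have contP g x : Gamma x -> (forall y, Gamma y -> {for y, continuous g}) ->
    {for x, continuous (g \o map_powR a)}.
  move=> x0 cg; apply: continuous_comp; first exact: continuous_map_powR.
  exact/cg/Gamma_map_powR.
elim: k f => [|k IH] f fk; first by split=> // x x0; apply: contP => //; exact: fk.1.
apply: C_kS => [x x0|i]; first by apply: contP => //; exact: fk.1.
exists ((pderiv i f \o map_powR a) * (cst a * (fun x => x ord0 i `^ (a - 1)))).
  apply: C_kM; first by apply: IH; exact: (fk.2 i).2.
  apply: C_kM; first exact: C_k_cst.
  by apply: C_k_powR => [x|]; [exact|exact: C_k_coord].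
move=> x x0; apply: is_derive_comp_map_powR => //.
exact: C_k_is_derive fk (Gamma_map_powR a x0).
Qed.

End Smoothness.

(** * From positive partial derivatives to monotonicity and positivity *)

Section Monotonicity.
Variables (R : realType) (n : nat) (f : 'rV[R]_n -> R).
Implicit Types (x y : 'rV[R]_n) (i : 'I_n).
Hypotheses (f_smooth : smooth_on_Gamma f) (f_mono : strictly_monotone f).

Local Notation Gamma := (@Gamma_plus R n).

Lemma Gamma_line x i (h : R) : Gamma x -> 0 <= h -> Gamma (h *: ebasis R i + x).
Proof.
move=> x0 h0 j; rewrite !mxE; apply: ltr_wpDl; last exact: x0.
by rewrite mulr_ge0// ler0n.
Qed.

Lemma lt_line x i (d : R) : Gamma x -> 0 < d -> f x < f (d *: ebasis R i + x).
Proof.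
move=> x0 d0; pose F (h : R) := f (h *: ebasis R i + x).
have dF (h : R) : 0 <= h -> is_derive h 1 F (pderiv i f (h *: ebasis R i + x)).
  move=> h0; have xh := Gamma_line i x0 h0.
  have /derivableP/is_derive_line df := (f_smooth [::] xh).2 i.
  (* Recentring the line at the point of parameter [h] turns the derivative of [F] at [h] into one
     at [0]. *)
  have -> : F =
      (fun k => f (k *: ebasis R i + (h *: ebasis R i + x))) \o shift (- h).
    by apply/funext => k /=; rewrite addrA -scalerDl subrK.
  rewrite -[X in is_derive _ _ _ X]mulr1.
  apply: is_derive_comp1; first exact: is_derive_shift.
  by rewrite /= subrr.
have dF1 (h : R) : 0 <= h -> derivable F h 1 by move=> /dF[].
have [] := @MVT _ F (fun h => pderiv i f (h *: ebasis R i + x)) 0 d d0.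
- by move=> h /[!in_itv]/= /andP[/ltW h0 _]; exact: dF.
- by apply: derivable_within_continuous => h /[!in_itv]/= /andP[h0 _]; exact: dF1.
move=> c /[!in_itv]/= /andP[/ltW c0 _]; rewrite {1 2}/F scale0r add0r subr0 => E.
by rewrite -subr_gt0 E mulr_gt0//; exact/f_mono/Gamma_line.
Qed.

Lemma le_Gamma x y : Gamma x -> Gamma y -> (forall i, x ord0 i <= y ord0 i) ->
  f x <= f y.
Proof.
move=> x0 y0 xy.
(* Path from [x] to [y] replacing one coordinate at a time: [z k] and [z k.+1] differ at most in
   coordinate [k]. *)
pose z k : 'rV[R]_n := \row_j (if (j < k)%N then y ord0 j else x ord0 j).
have z0 k : Gamma (z k) by move=> j; rewrite mxE; case: ifP.
have zn : z n = y by apply/rowP => j; rewrite mxE ltn_ord.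
suff H k : (k <= n)%N -> f x <= f (z k) by rewrite -zn; exact: H.
elim: k => [_|k IH kn].
  by rewrite (_ : z 0%N = x)//; apply/rowP => j; rewrite mxE.
apply: le_trans (IH (ltnW kn)) _; pose i := Ordinal kn.
have -> : z k.+1 = (y ord0 i - x ord0 i) *: ebasis R i + z k.
  apply/rowP => j; rewrite !mxE eqxx /= ltnS leq_eqVlt -(inj_eq val_inj) /=.
  case: eqVneq => [jk|_]; last by rewrite mulr0 add0r.
  by rewrite (_ : j = i) ?ltnn ?mulr1 ?subrK//; exact: val_inj.
have := xy i; rewrite -subr_ge0 le_eqVlt => /predU1P[<-|d0].
  by rewrite scale0r add0r.
exact/ltW/lt_line.
Qed.

(** Monotonicity gives [f x < f (2 *: x)], and the right side is [2 * f x]. The index [i] witnesses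
    that the dimension is nonzero and provides the strict increase. *)
Lemma homogeneous_gt0 (i : 'I_n) x : homogeneous1 f -> Gamma x -> 0 < f x.
Proof.
move=> fH x0; have x20 : Gamma (2 *: x) by move=> j; rewrite mxE mulr_gt0.
suff : f x < f (2 *: x) by rewrite fH// mulr2n mulrDl mul1r ltrDl.
apply: lt_le_trans (lt_line i x0 (x0 i)) _; apply: le_Gamma => //.
  by apply: Gamma_line => //; exact/ltW.
move=> j; rewrite !mxE eqxx /= mulr2n mulrDl mul1r lerD2r.
by case: eqVneq => [->|_]; rewrite ?mulr1 ?mulr0//; exact/ltW.
Qed.

End Monotonicity.

(** * Scalar convexity inequalities and concavity from a level set *)

Section Concavity.
Variable R : realType.

Lemma conv_gt0 (t a b : R) : 0 <= t <= 1 -> 0 < a -> 0 < b ->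
  0 < (1 - t) * a + t * b.
Proof.
move=> /andP[t0 t1] a0 b0; move: t0; rewrite le_eqVlt => /predU1P[<-|t0].
  by rewrite subr0 mul1r mul0r addr0.
by rewrite ltr_wpDl// ?mulr_gt0// mulr_ge0 ?subr_ge0// ltW.
Qed.

Lemma concave_powR (s t a b : R) : 0 < s <= 1 -> 0 <= t <= 1 -> 0 < a -> 0 < b ->
  (1 - t) * a `^ s + t * b `^ s <= ((1 - t) * a + t * b) `^ s.
Proof.
move=> /andP[s0 s1] /andP[t0 t1] a0 b0.
have t1' : 0 <= 1 - t by rewrite subr_ge0.
have u1 : 1 - t <= 1 by rewrite gerBl.
have p1 : 1 <= s^-1 by rewrite invf_ge1.
(* Convexity of the power [s^-1 >= 1] at the points [a]^ s[and]b [^ s]; raising the result to the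
   power [s] gives the claim. *)
have := @convex_powR R _ p1 (Itv01 t1' u1) (a `^ s) (b `^ s).
rewrite !inE /= !in_itv /= !andbT !powR_ge0 => /(_ isT isT).
rewrite convRE [X in X `^ _ <= _]convRE /= unstable.onemK.
rewrite -!powRrM mulfV ?gt_eqF// !powRr1 ?(ltW a0) ?(ltW b0)// => H.
have L0 : 0 <= (1 - t) * a `^ s + t * b `^ s.
  by apply: addr_ge0; apply: mulr_ge0 => //; exact: powR_ge0.
apply: le_trans (ge0_ler_powR (ltW s0) _ _ H).
- by rewrite -powRrM mulVf ?gt_eqF// powRr1.
- by rewrite nnegrE powR_ge0.
- by rewrite nnegrE ltW// conv_gt0 ?t0.
Qed.

Lemma convex_inv (t a b : R) : 0 <= t <= 1 -> 0 < a -> 0 < b ->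
  ((1 - t) * a + t * b)^-1 <= (1 - t) * a^-1 + t * b^-1.
Proof.
move=> t01 a0 b0; have D0 := conv_gt0 t01 a0 b0; have /andP[t0 t1] := t01.
rewrite -subr_ge0.
have -> : (1 - t) * a^-1 + t * b^-1 - ((1 - t) * a + t * b)^-1 =
   (1 - t) * t * (a - b) ^+ 2 / (a * b * ((1 - t) * a + t * b)).
  by field; rewrite !gt_eqF.
apply: divr_ge0; last by rewrite ltW// !mulr_gt0.
by apply: mulr_ge0; [apply: mulr_ge0; rewrite ?subr_ge0|exact: sqr_ge0].
Qed.

Variable n : nat.
Implicit Types (g : 'rV[R]_n -> R) (x y : 'rV[R]_n).
Local Notation Gamma := (@Gamma_plus R n).

Lemma Gamma_conv (t : R) x y : 0 <= t <= 1 -> Gamma x -> Gamma y ->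
  Gamma ((1 - t) *: x + t *: y).
Proof. by move=> t01 x0 y0 i; rewrite !mxE; exact: conv_gt0. Qed.

Lemma concave_superlevel g : homogeneous1 g -> (forall x, Gamma x -> 0 < g x) ->
  (forall x y (t : R), Gamma x -> Gamma y -> 0 <= t <= 1 -> g x = 1 -> g y = 1 ->
     1 <= g ((1 - t) *: x + t *: y)) ->
  concave_on_Gamma g.
Proof.
move=> gH g0 gl x y t x0 y0 t01; have /andP[t0 t1] := t01.
have [gx gy] := (g0 x x0, g0 y y0).
pose s := (1 - t) * g x + t * g y.
have s0 : 0 < s by exact: conv_gt0.
(* Chosen so that [s * t' / g y = t] and [s * (1 - t') / g x = 1 - t]: the original combination is
   [s] times one of the rescaled points. *)
pose t' := t * g y / s.
have t'01 : 0 <= t' <= 1.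
  have gxy : 0 <= (1 - t) * g x /\ 0 <= t * g y.
    by split; apply: mulr_ge0; rewrite ?subr_ge0// ltW.
  apply/andP; split; first exact: divr_ge0 gxy.2 (ltW s0).
  by rewrite ler_pdivrMr// mul1r lerDr gxy.1.
have -> : (1 - t) *: x + t *: y =
    s *: ((1 - t') *: ((g x)^-1 *: x) + t' *: ((g y)^-1 *: y)).
  rewrite scalerDr !scalerA; congr (_ *: _ + _ *: _); rewrite /t'.
    rewrite /s in s0 *; field; rewrite !gt_eqF//.
  rewrite /s in s0 *; field; rewrite !gt_eqF//.
have G z : Gamma z -> Gamma ((g z)^-1 *: z).
  by move=> z0 i; rewrite mxE mulr_gt0// ?invr_gt0 ?g0.
have N z : Gamma z -> g ((g z)^-1 *: z) = 1.
  by move=> z0; rewrite gH ?invr_gt0 ?g0// mulVf// gt_eqF// g0.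
rewrite gH//; last by apply: Gamma_conv => //; exact: G.
rewrite -/s -[leLHS]mulr1 ler_pM2l//.
by apply: gl => //; [exact: G|exact: G|exact: N|exact: N].
Qed.

End Concavity.

(** * The defining properties of the class for [f_pow f r] *)

Section PowerMean.
Variables (R : realType) (n : nat) (f : 'rV[R]_n -> R).
Implicit Types (x y : 'rV[R]_n) (r : R).
Local Notation Gamma := (@Gamma_plus R n).
Hypotheses (fC : class_C f) (f0 : forall x, Gamma x -> 0 < f x).

Lemma f_pow_gt0 r x : Gamma x -> 0 < f_pow f r x.
Proof. by move=> x0; apply/powR_gt0/f0/Gamma_map_powR. Qed.

Lemma smooth_f_pow r : smooth_on_Gamma (f_pow f r).
Proof.
apply/smooth_C_k => k; apply: (@C_k_powR _ _ k (f \o map_powR r)).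
  by move=> x x0; exact/f0/Gamma_map_powR.
by apply: C_k_comp_map_powR; have [/smooth_C_k + _ _ _ _] := fC.
Qed.

Lemma homogeneous_f_pow r : r != 0 -> homogeneous1 (f_pow f r).
Proof.
move=> r0 c x c0 x0; have [_ fH _ _ _] := fC.
have E : map_powR r (c *: x) = c `^ r *: map_powR r x.
  by apply/rowP => i; rewrite !mxE powRM// ltW.
rewrite /f_pow -!/(map_powR r _) E fH ?powR_gt0//; last exact: Gamma_map_powR.
rewrite powRM ?powR_ge0//; last exact/ltW/f0/Gamma_map_powR.
by rewrite -powRrM mulfV// powRr1// ltW.
Qed.

Lemma strictly_monotone_f_pow r : r != 0 -> strictly_monotone (f_pow f r).
Proof.
move=> r0 x x0 i; have [/smooth_C_k fs _ fm _ _] := fC.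
have rx0 := Gamma_map_powR r x0.
have df := is_derive_comp_map_powR x0 (C_k_is_derive i (fs 1%N) rx0).
have [_ dF] := @is_derive_powR_comp _ _ (f \o map_powR r) x i r^-1 _ (f0 rx0) df.
rewrite /pderiv [X in 0 < X]dF /=.
(* The inner and outer powers contribute [r] and [r^-1], whose product is [1]: the sign of [r]
   cancels. *)
rewrite (_ : _ * _ = (r^-1 * r) * (f (map_powR r x) `^ (r^-1 - 1) *
   pderiv i f (map_powR r x) * x ord0 i `^ (r - 1))); last by ring.
by rewrite mulVf// mul1r !mulr_gt0 ?powR_gt0//; [exact: f0|exact: fm].
Qed.

Lemma concave_f_pow r : -1 <= r <= 1 -> r != 0 -> concave_on_Gamma (f_pow f r).
Proof.
move=> /andP[rN1 r1] r0; have [fs fH fm fc fic] := fC.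
apply: concave_superlevel; [exact: homogeneous_f_pow|exact: f_pow_gt0|].
have level x : Gamma x -> f_pow f r x = 1 -> f (map_powR r x) = 1.
  move=> x0 /(congr1 (fun u => u `^ r)); rewrite /f_pow -/(map_powR r x).
  by rewrite powR1 -powRrM mulVf// powRr1// ltW// f0//; exact: Gamma_map_powR.
move=> x y t x0 y0 t01 /(level _ x0) fx /(level _ y0) fy.
set z := (1 - t) *: x + t *: y; have z0 : Gamma z by exact: Gamma_conv.
have fz0 := f0 (Gamma_map_powR r z0).
have one_powR (p : R) : 1 `^ p = 1 :> R by rewrite powR1.
rewrite /f_pow -/(map_powR r z).
move: r0; rewrite neq_lt => /orP[r_lt0|r_gt0].
- have s01 : 0 < - r <= 1 by rewrite oppr_gt0 r_lt0 lerNl.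
  have invE u : Gamma u -> inv_vec (map_powR (- r) u) = map_powR r u.
    by move=> u0; apply/rowP => i; rewrite !mxE powRN invrK.
  set w := (1 - t) *: map_powR (- r) x + t *: map_powR (- r) y.
  have w0 : Gamma w by apply: Gamma_conv => //; exact: Gamma_map_powR.
  have iw0 : Gamma (inv_vec w) by move=> i; rewrite mxE invr_gt0.
  (* The outer exponent [r^-1] is negative and reverses the inequality. *)
  suff fz1 : f (map_powR r z) <= 1.
    rewrite -[r^-1]opprK powRN -invrN invf_ge1 ?powR_gt0//.
    rewrite -(one_powR (- r)^-1); apply: ge0_ler_powR => //.
    + by rewrite invr_ge0 oppr_ge0 ltW.
    + by rewrite nnegrE ltW.
    + by rewrite nnegrE.
  (* Concavity of the power [- r] puts [w] below [map_powR (- r) z] coordinatewise; inverting,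
     [map_powR r z] lies below [inv_vec w]. Concavity of [fstar f] then bounds [f (inv_vec w)] by
     [1]. *)
  apply: (@le_trans _ _ (f (inv_vec w))).
    apply: le_Gamma => //; first exact: Gamma_map_powR.
    move=> i; rewrite -(invE _ z0) !mxE lef_pV2 ?posrE ?powR_gt0//.
    + by apply: concave_powR.
    + by have := z0 i; rewrite !mxE.
    + by have := w0 i; rewrite !mxE.
  have := fic _ _ t (Gamma_map_powR (- r) x0) (Gamma_map_powR (- r) y0) t01.
  rewrite /fstar !invE// fx fy -/w lerNr => /le_trans; apply.
  by rewrite le_eqVlt; apply/orP; left; apply/eqP; ring.
- set w := (1 - t) *: map_powR r x + t *: map_powR r y.
  have w0 : Gamma w by apply: Gamma_conv => //; exact: Gamma_map_powR.
  rewrite -(one_powR r^-1); apply: ge0_ler_powR => //.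
  + by rewrite invr_ge0 ltW.
  + by rewrite nnegrE.
  + by rewrite nnegrE ltW.
  (* Concavity of [f] gives [1 <= f w], and concavity of the power [r] puts [w] below [map_powR r z]
     coordinatewise. *)
  apply: (@le_trans _ _ (f w)).
    have := fc _ _ t (Gamma_map_powR r x0) (Gamma_map_powR r y0) t01.
    by rewrite fx fy !mulr1 subrK.
  apply: le_Gamma => //; first exact: Gamma_map_powR.
  by move=> i; rewrite !mxE; apply: concave_powR => //; rewrite r_gt0.
Qed.

Lemma f_pow_inv_vec r x : Gamma x ->
  f_pow f r (inv_vec x) = (f_pow f (- r) x)^-1.
Proof.
move=> x0; rewrite /f_pow invrN powRN invrK; congr (f _ `^ _).
by apply/rowP => i; rewrite !mxE powRN -powR_inv1 ?ltW// -powRrM mulN1r powRN.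
Qed.

(** The reciprocal of the positive concave function [f_pow f (- r)] is convex, because inversion is
    decreasing and convex. *)
Lemma inverse_concave_f_pow r :
  -1 <= r <= 1 -> r != 0 -> inverse_concave (f_pow f r).
Proof.
move=> /andP[rN1 r1] r0 x y t x0 y0 t01.
rewrite /fstar !f_pow_inv_vec//; last exact: Gamma_conv.
rewrite !mulrN -opprD lerN2.
have Nr1 : -1 <= - r <= 1 by rewrite lerN2 r1 lerNl.
have := concave_f_pow Nr1 _ x0 y0 t01; rewrite oppr_eq0 => /(_ r0) H.
have [gx gy] := (f_pow_gt0 (- r) x0, f_pow_gt0 (- r) y0).
have le_inv (u v : R) : 0 < u -> u <= v -> v^-1 <= u^-1.
  by move=> u0 uv; rewrite lef_pV2 ?posrE// (lt_le_trans u0).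
exact: le_trans (le_inv _ _ (conv_gt0 t01 gx gy) H) (convex_inv t01 gx gy).
Qed.

End PowerMean.

Unset Implicit Arguments.

Theorem theorem2p3 (R : realType) (n : nat) (f : 'rV[R]_n -> R) (r : R) :
  class_C f -> -1 <= r <= 1 -> r != 0 -> class_C (f_pow f r).
Proof.
move=> fC r1 r0; have [fs fH fm fc fic] := fC.
have [n0|n_gt0] := posnP n.
  (* In dimension zero positivity fails: the space is a single point, homogeneity forces [f = 0],
     and [0] to a nonzero power is [0]. *)
  suff -> : f_pow f r = f by [].
  have noI (i : 'I_n) : False by case: i => m; rewrite n0.
  have f_eq0 x : f x = 0.
    have : f (2 *: x) = 2 * f x by apply: fH => // i; case: (noI i).
    rewrite (_ : 2 *: x = x); last by apply/rowP => i; case: (noI i).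
    by move/eqP; rewrite mulr2n mulrDl mul1r eq_sym -subr_eq0 addrK => /eqP.
  by apply/funext => x; rewrite /f_pow !f_eq0 powR0// invr_eq0.
have f0 x : Gamma_plus x -> 0 < f x.
  exact: (homogeneous_gt0 fs fm (Ordinal n_gt0)).
split; [exact: smooth_f_pow|exact: homogeneous_f_pow|exact: strictly_monotone_f_pow|
  exact: concave_f_pow|exact: inverse_concave_f_pow].
Qed.
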